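(* Let $\mathcal{L}$ be a complete modular lattice and let $\mathfrak{m}$ be a submonoid with zero of $\mathrm{End}_{lin}(\mathcal{L})$ that is closed under complements. The following conditions are equivalent: (a) $\mathcal{L}$ is $\mathfrak{m}$-endoregular. (b) $\mathcal{L}$ is $\mathfrak{m}$-Rickart and satisfies the condition $\mathfrak{m}$-$C_2$. (c) $\mathcal{L}$ is dual-$\mathfrak{m}$-Rickart and satisfies the condition $\mathfrak{m}$-$D_2$. (d) $\ker_\varphi$ and $\varphi(\mathbf{1})$ have a complement in $\mathcal{L}$ for every $\varphi\in\mathfrak{m}$.
   Context: $\mathbf{0},\mathbf{1}$ denote the least and greatest elements of a lattice; $[a,b]=\{x: a\le x\le b\}$. An element $x$ ''is a complement'' (or ''has a complement'') in $\mathcal{L}$ if there is $x'$ with $x\wedge x'=\mathbf{0}$, $x\vee x'=\mathbf{1}$. Linear morphism: a map $\varphi:\mathcal{L}\to\mathcal{L}'$ between bounded lattices is linear if there exist $\ker_\varphi\in\mathcal{L}$ (the kernel) and $a'\in\mathcal{L}'$ such that (1) $\varphi(x)=\varphi(x\vee\ker_\varphi)$ for all $x\in\mathcal{L}$; (2) $\varphi$ restricts to a lattice isomorphism $\overline{\varphi}:[\ker_\varphi,\mathbf{1}]\to[\mathbf{0},a']$ (so $a'=\varphi(\mathbf{1})$). $\mathrm{End}_{lin}(\mathcal{L})$ is the monoid of linear morphisms $\mathcal{L}\to\mathcal{L}$ under composition; its zero is the constant map $\mathbf{0}$. A submonoid with zero contains the identity and the zero morphism. For $x\in\mathcal{L}$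 with complement $x'$, the projection $\pi_x$ (with respect to $x'$) is $\pi_x(a)=(a\vee x')\wedge x$, a linear morphism, viewed with codomain $\mathcal{L}$ or $[\mathbf{0},x]$. $\iota_x:[\mathbf{0},x]\to\mathcal{L}$ is the inclusion and $\rho_a:\mathcal{L}\to[a,\mathbf{1}]$ is $\rho_a(y)=a\vee y$. $\mathfrak{m}$ is closed under complements if for every $\varphi\in\mathfrak{m}$ and all $x,y$ having complements in $\mathcal{L}$ such that $\varphi$ restricts to an isomorphism $\varphi|_x:[\mathbf{0},x]\to[\mathbf{0},y]$, one has $\iota_x(\varphi|_x)^{-1}\pi_y\in\mathfrak{m}$ (for every choice of complement of $y$ defining $\pi_y$). $\mathcal{L}$ is $\mathfrak{m}$-endoregular if $\mathfrak{m}$ is a regular monoid: for each $\varphi\in\mathfrak{m}$ there is $\psi\in\mathfrak{m}$ with $\varphi=\varphi\psi\varphi$. $\mathcal{L}$ is $\mathfrak{m}$-Rickart if $\ker_\varphi$ has a complement for all $\varphi\in\mathfrak{m}$, and dual-$\mathfrak{m}$-Rickart if $\varphi(\mathbf{1})$ has a complement for all $\varphi\in\mathfrak{m}$. $\mathfrak{m}$-$C_2$: whenever $a,x,x'\in\mathcal{L}$, $x'$ is a complement of $x$, $\theta:[\mathbf{0},x]\to[\mathbf{0},a]$ is an isomorphism and $\iota_a\theta\pi_x\in\mathfrak{m}$ ($\pi_x$ with respect to $x'$), then $a$ is a complement in $\mathcal{L}$. $\mathfrak{m}$-$D_2$: whenever $a,x\in\mathcal{L}$, $x$ is a complement in $\mathcal{L}$,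 $\theta:[a,\mathbf{1}]\to[\mathbf{0},x]$ is an isomorphism and $\iota_x\theta\rho_a\in\mathfrak{m}$, then $a$ is a complement in $\mathcal{L}$. *)

(* Defs.v *)
From mathcomp Require Import all_boot all_order interval.
From mathcomp Require Import boolp classical_sets functions set_interval.

Set Implicit Arguments.
Unset Strict Implicit.
Unset Printing Implicit Defensive.

Import Order.TTheory.
Local Open Scope order_scope.

(* Intervals are kept as subsets of the ambient lattice, whose meet and join
   restrict to them: a map out of an interval is a map on the whole lattice of
   which only the values on the interval matter, and the inclusion of an
   interval is the identity on underlying elements. *)

Section LatticeNotions.
Context {d : Order.disp_t} {L : tbLatticeType d}.
Implicit Types (x y z a b : L) (S : set L).

Definition complete_lattice : Prop :=
  forall S, (exists s, supremums S s) /\ (exists i, infimums S i).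

Definition modular_lattice : Prop :=
  forall x y z, x <= z -> x `|` (y `&` z) = (x `|` y) `&` z.

Definition is_complement x x' : Prop := x `&` x' = \bot /\ x `|` x' = \top.

Definition complemented x : Prop := exists x', is_complement x x'.

(* The projection onto [\bot, x] with respect to the complement x' of x. *)
Definition proj x x' : L -> L := fun a => (a `|` x') `&` x.

Definition rho a : L -> L := fun y => a `|` y.

End LatticeNotions.

Arguments complete_lattice {d} L.
Arguments modular_lattice {d} L.

Section LinearMorphisms.
Context {d d' : Order.disp_t} {L : tbLatticeType d} {L' : tbLatticeType d'}.
Implicit Types (f : L -> L') (k : L).

(* For A and B sublattices, f restricts to a lattice isomorphism A -> B. *)
Definition lattice_iso_on (A : set L) (B : set L') f : Prop :=
  [/\ set_bij A B f,
      forall x y, A x -> A y -> f (x `&` y) = f x `&` f y &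
      forall x y, A x -> A y -> f (x `|` y) = f x `|` f y].

Definition is_kernel f k : Prop :=
  (forall x, f x = f (x `|` k)) /\
  exists a', lattice_iso_on `[k, \top]%classic `[\bot, a']%classic f.

Definition linear_morphism f : Prop := exists k, is_kernel f k.

(* The kernel as a total function; it is \bot when f is not linear. *)
Definition ker f : L := xget \bot [set k | is_kernel f k]%classic.

Lemma kerP f : linear_morphism f -> is_kernel f (ker f).
Proof. exact: (@xgetPex _ \bot [set k | is_kernel f k]%classic). Qed.

Lemma is_kernel_bot f k x : is_kernel f k -> (f x = \bot) <-> (x <= k).
Proof.
move=> [fk [a' [[_ inj surj] meetf _]]].
have inI y : k <= y -> `[k, \top]%classic y.
  by move=> ky; rewrite /= in_itv /= ky lex1.
have fk0 : f k = \bot.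
  have [|y + fy] := surj \bot; first by rewrite /= in_itv /= lexx le0x.
  rewrite /= in_itv /= => /andP[ky _].
  by rewrite -(meet_l ky) meetf ?fy ?meetx0 //; apply: inI.
split=> [fx | xk]; last by rewrite fk (join_r xk).
have <- : x `|` k = k; last exact: leUl.
by apply: inj; rewrite ?inE ?fk0 -?fk //; apply: inI => //; apply: leUr.
Qed.

Lemma is_kernel_uniq f k1 k2 : is_kernel f k1 -> is_kernel f k2 -> k1 = k2.
Proof.
move=> h1 h2; apply/eqP; rewrite eq_le; apply/andP; split.
  by apply/(is_kernel_bot _ h2)/(is_kernel_bot _ h1).
by apply/(is_kernel_bot _ h1)/(is_kernel_bot _ h2).
Qed.

End LinearMorphisms.

Section EndomorphismMonoid.
Context {d : Order.disp_t} {L : tbLatticeType d}.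
Implicit Types (m : set (L -> L)) (a x y : L).

Definition submonoid_with_zero m : Prop :=
  [/\ forall phi, m phi -> linear_morphism phi,
      m id,
      m (fun=> \bot) &
      forall phi psi, m phi -> m psi -> m (phi \o psi)].

(* 'pinv_(fun=> \bot) `[\bot, x] phi is the inverse of the restriction of phi
   to [\bot, x]; it is only applied to elements of the image [\bot, y]. *)
Definition closed_under_complements m : Prop :=
  forall phi x y y', m phi -> complemented x -> is_complement y y' ->
    lattice_iso_on `[\bot, x]%classic `[\bot, y]%classic phi ->
    m ('pinv_(fun=> \bot) `[\bot, x]%classic phi \o proj y y').

Definition endoregular m : Prop :=
  forall phi, m phi -> exists2 psi, m psi & phi = phi \o psi \o phi.

Definition rickart m : Prop := forall phi, m phi -> complemented (ker phi).

Definition dual_rickart m : Prop := forall phi, m phi -> complemented (phi \top).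

Definition cond_C2 m : Prop :=
  forall a x x' (theta : L -> L), is_complement x x' ->
    lattice_iso_on `[\bot, x]%classic `[\bot, a]%classic theta ->
    m (theta \o proj x x') -> complemented a.

Definition cond_D2 m : Prop :=
  forall a x (theta : L -> L), complemented x ->
    lattice_iso_on `[a, \top]%classic `[\bot, x]%classic theta ->
    m (theta \o rho a) -> complemented a.

End EndomorphismMonoid.

(* Main.v *)
Require Import Defs.
From mathcomp Require Import all_boot all_order.
From mathcomp Require Import boolp classical_sets.
From mathcomp Require Import interval functions set_interval.

(** Everything reduces to the kernel and the image of a single morphism [phi]
    in [m]. Write [k] for the kernel of [phi] and [a] for [phi \top].

    If [k] has a complement [k'], then [phi] restricts to an isomorphism from
    the interval below [k'] onto the interval below [a]
    ([kernel_complement_iso]): modularity identifies the interval below [k']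
    with the interval above [k] by [y |-> y `|` k], and [phi] does not see the
    join with [k]. When [a] is complemented too, closure under complements puts
    the inverse of this isomorphism, precomposed with the projection onto [a],
    into [m]; since the projection fixes everything below [a], this is a
    quasi-inverse of [phi]. So complemented kernels and images make [m] regular.

    Conversely, a quasi-inverse [psi] of [phi] yields the idempotents
    [psi \o phi], with the kernel of [phi], and [phi \o psi], with the image of
    [phi]; the kernel and the image of an idempotent complement each other
    ([idempotent_complement]).

    The conditions C2 and D2 carry complementedness from the kernel of a member
    of [m] to its image and back. If [k] is complemented by [k'], then
    [phi = phi \o proj k' k] is an instance of C2; whenever [a] is complemented,
    [phi = phi \o rho k] is an instance of D2. In the other direction, the
    element that C2 has to complement is the image of the morphism in its
    hypothesis, and the one that D2 has to complement is the kernel of its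
    morphism; so C2 holds once all images are complemented, and D2 once all
    kernels are. *)

Set Implicit Arguments.
Unset Strict Implicit.

Import Order.TTheory.
Local Open Scope order_scope.

(** * Lattice isomorphisms between intervals *)

Section Isomorphisms.
Context {d d' : Order.disp_t} {L : tbLatticeType d} {L' : tbLatticeType d'}.

Lemma in_lower_interval (x y : L) : (`[\bot, x]%classic y : Prop) = (y <= x).
Proof. by rewrite /= in_itv /= le0x. Qed.

Lemma in_upper_interval (x y : L) : (`[x, \top]%classic y : Prop) = (x <= y).
Proof. by rewrite /= in_itv /= lex1 andbT. Qed.

Lemma lattice_iso_on_top {a b : L} {c e : L'} {f : L -> L'} :
  a <= b -> c <= e -> lattice_iso_on `[a, b]%classic `[c, e]%classic f ->
  f b = e.
Proof.
move=> ab ce [[funf _ surj] meetf _].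
have Ab : `[a, b]%classic b by rewrite /= in_itv /= ab lexx.
have /= := funf _ Ab; rewrite in_itv /= => /andP[_ fbe].
have [|z Az fz] := surj e; first by rewrite /= in_itv /= ce lexx.
apply/eqP; rewrite eq_le fbe /= -fz.
have /= := Az; rewrite in_itv /= => /andP[_ zb].
by rewrite -(meet_l zb) meetf // leIr.
Qed.

Lemma eq_lattice_iso_on {a b : L} {B : set L'} {f g : L -> L'} :
  {in `[a, b]%classic, f =1 g} -> lattice_iso_on `[a, b]%classic B f ->
  lattice_iso_on `[a, b]%classic B g.
Proof.
move=> fg [bijf meetf joinf].
have fgE x : `[a, b]%classic x -> g x = f x by move=> ?; rewrite fg ?inE.
split; first exact: eq_set_bijRL bijf.
  move=> x y Ax Ay; rewrite !fgE ?meetf //.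
  move: Ax Ay; rewrite /= !in_itv /= => /andP[ax xb] /andP[ay _].
  by rewrite lexI ax ay (le_trans (leIl _ _) xb).
move=> x y Ax Ay; rewrite !fgE ?joinf //.
move: Ax Ay; rewrite /= !in_itv /= => /andP[ax xb] /andP[_ yb].
by rewrite leUx xb yb (le_trans ax (leUl _ _)).
Qed.

End Isomorphisms.

Lemma lattice_iso_on_comp {d1 d2 d3 : Order.disp_t} {L1 : tbLatticeType d1}
    {L2 : tbLatticeType d2} {L3 : tbLatticeType d3}
    {A : set L1} {B : set L2} {C : set L3} {f : L1 -> L2} {g : L2 -> L3} :
  lattice_iso_on A B f -> lattice_iso_on B C g -> lattice_iso_on A C (g \o f).
Proof.
move=> [bijf meetf joinf] [bijg meetg joing].
have funf : set_fun A B f by case: bijf.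
split; first exact: set_bij_comp bijf bijg.
  by move=> x y Ax Ay; rewrite /= meetf // meetg //; apply: funf.
by move=> x y Ax Ay; rewrite /= joinf // joing //; apply: funf.
Qed.

(** * Complements and projections in a modular lattice *)

Section Complements.
Context {d : Order.disp_t} {L : tbLatticeType d}.

Lemma is_complement_sym (x x' : L) : is_complement x x' -> is_complement x' x.
Proof. by case; rewrite meetC joinC. Qed.

Lemma proj_top (x x' : L) : proj x x' \top = x.
Proof. by rewrite /proj join1x meet1x. Qed.

Hypothesis Lmodular : modular_lattice L.

Lemma proj_id (x x' a : L) : is_complement x x' -> a <= x -> proj x x' a = a.
Proof.
by move=> [xx' _] ax; rewrite /proj -Lmodular // meetC xx' joinx0.
Qed.

Lemma join_proj (x x' a : L) :
  is_complement x x' -> proj x x' a `|` x' = a `|` x'.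
Proof.
move=> [_ xx']; rewrite /proj joinC meetC Lmodular ?leUr //.
by rewrite [x' `|` x]joinC xx' meet1x.
Qed.

(** The diamond isomorphism of modular lattices, whose inverse is
    [w |-> w `&` x]. Preservation of meets is read off from the inverse, which
    visibly preserves them. *)
Lemma complement_diamond_iso (x x' : L) : is_complement x x' ->
  lattice_iso_on `[\bot, x]%classic `[x', \top]%classic (fun y => y `|` x').
Proof.
move=> xx'; have [_ xUx'] := xx'.
have projK y : y <= x -> (y `|` x') `&` x = y by exact: proj_id.
have joinK w : x' <= w -> (w `&` x) `|` x' = w.
  by move=> x'w; rewrite joinC meetC Lmodular // [x' `|` x]joinC xUx' meet1x.
split; first split.
- by move=> y _; rewrite in_upper_interval leUr.
- move=> y z; rewrite !inE !in_lower_interval => yx zx yz.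
  by rewrite -(projK y) // yz projK.
- move=> w; rewrite in_upper_interval => x'w.
  by exists (w `&` x); [rewrite in_lower_interval leIr | exact: joinK].
- move=> y z; rewrite !in_lower_interval => yx zx.
  rewrite -[RHS]joinK ?lexI ?leUr //; congr (_ `|` _).
  by rewrite -{1}(projK y) // -{1}(projK z) // meetACA meetxx.
- by move=> y z _ _; rewrite joinACA joinxx.
Qed.

End Complements.

(** * Linear morphisms *)

Section Linear.
Context {d d' : Order.disp_t} {L : tbLatticeType d} {L' : tbLatticeType d'}.
Implicit Types (f : L -> L') (k x : L).

Lemma is_kernel_iso {f k} : is_kernel f k ->
  lattice_iso_on `[k, \top]%classic `[\bot, f \top]%classic f.
Proof.
by move=> [_ [a' fiso]]; rewrite (lattice_iso_on_top (lex1 k) (le0x a') fiso).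
Qed.

Lemma is_kernel_ker f k : is_kernel f k -> ker f = k.
Proof. move=> fk; have lin : linear_morphism f by exists k.
exact: is_kernel_uniq (kerP lin) fk. Qed.

Lemma is_kernel_join f k x y : is_kernel f k -> f (x `|` y) = f x `|` f y.
Proof.
move=> [fk [a' [_ _ joinf]]].
rewrite fk (fk x) (fk y) -joinf ?in_upper_interval ?leUr //.
by rewrite joinACA joinxx.
Qed.

Lemma is_kernel_mono f k x y : is_kernel f k -> x <= y -> f x <= f y.
Proof.
by move=> fk xy; rewrite -(join_r xy) (is_kernel_join _ _ fk) leUl.
Qed.

Lemma kernel_complement_iso f k k' : modular_lattice L -> is_kernel f k ->
  is_complement k k' ->
  lattice_iso_on `[\bot, k']%classic `[\bot, f \top]%classic f.
Proof.
move=> Lmodular fk /is_complement_sym k'k.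
apply: eq_lattice_iso_on
  (lattice_iso_on_comp (complement_diamond_iso Lmodular k'k)
    (is_kernel_iso fk)).
by move=> x _ /=; case: fk => <-.
Qed.

Lemma is_kernel_comp_rho (a : L) (b : L') (theta : L -> L') :
  lattice_iso_on `[a, \top]%classic `[\bot, b]%classic theta ->
  is_kernel (theta \o rho a) a.
Proof.
move=> thetaiso; split=> [x|]; first by rewrite /= /rho joinCA joinxx joinC.
exists b; apply: eq_lattice_iso_on thetaiso => x.
by rewrite inE in_upper_interval /= /rho => /join_r ->.
Qed.

End Linear.

Section Idempotents.
Context {d : Order.disp_t} {L : tbLatticeType d}.

(** A fixed point in the kernel is [\bot]; and [e] identifies
    [k `|` e \top] with [\top], while it is injective above [k]. *)
Lemma idempotent_complement (e : L -> L) (k : L) : is_kernel e k ->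
  (forall x, e (e x) = e x) -> is_complement k (e \top).
Proof.
move=> ek ee; have [[_ inje surje] _ _] := is_kernel_iso ek; split.
  have [|y _ ey] := surje (k `&` e \top).
    by rewrite in_lower_interval leIr.
  by rewrite -ey -ee ey; apply/(is_kernel_bot _ ek); apply: leIl.
apply: inje; rewrite ?inE ?in_upper_interval ?leUl ?lex1 //.
by rewrite (is_kernel_join _ _ ek) ee join_r // (is_kernel_mono ek) ?lex1.
Qed.

End Idempotents.

(** * The four conditions *)

Section Conditions.
Context {d : Order.disp_t} {L : tbLatticeType d} {m : set (L -> L)}.
Hypothesis m_submonoid : submonoid_with_zero m.

Lemma is_kernel_submonoid phi : m phi -> is_kernel phi (ker phi).
Proof. by case: m_submonoid => lin _ _ _ /lin /kerP. Qed.

(** The idempotent [psi \o phi] kills nothing more than [phi] does, because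
    applying [phi] to it gives [phi] back. *)
Lemma endoregular_rickart : endoregular m -> rickart m.
Proof.
case: (m_submonoid) => _ _ _ mcomp reg phi mphi.
have [psi mpsi phiE] := reg phi mphi.
have me : m (psi \o phi) := mcomp _ _ mpsi mphi.
have phik := is_kernel_submonoid mphi; have ek := is_kernel_submonoid me.
have phiK x : phi (psi (phi x)) = phi x by rewrite [in RHS]phiE.
have phi0 : phi \bot = \bot by apply/(is_kernel_bot _ phik).
have psi0 : psi \bot = \bot.
  by apply/(is_kernel_bot _ (is_kernel_submonoid mpsi)).
exists (psi (phi \top)).
have <- : ker (psi \o phi) = ker phi.
  apply/eqP; rewrite eq_le; apply/andP; split.
    apply/(is_kernel_bot _ phik); rewrite -phiK.
    have -> : psi (phi (ker (psi \o phi))) = \bot.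
      by apply/(is_kernel_bot _ ek).
    exact: phi0.
  apply/(is_kernel_bot _ ek) => /=.
  by have -> : phi (ker phi) = \bot by apply/(is_kernel_bot _ phik).
by apply: (@idempotent_complement _ _ (psi \o phi)) ek _ => x /=; rewrite phiK.
Qed.

(** The image of the idempotent [phi \o psi] lies in that of [phi], and contains
    [phi \top] because [phi \top] is fixed by it. *)
Lemma endoregular_dual_rickart : endoregular m -> dual_rickart m.
Proof.
case: (m_submonoid) => _ _ _ mcomp reg phi mphi.
have [psi mpsi phiE] := reg phi mphi.
have phik := is_kernel_submonoid mphi.
have ek := is_kernel_submonoid (mcomp _ _ mphi mpsi).
have phiK x : phi (psi (phi x)) = phi x by rewrite [in RHS]phiE.
exists (ker (phi \o psi)); apply: is_complement_sym.
have <- : (phi \o psi) \top = phi \top.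
  apply/eqP; rewrite eq_le (is_kernel_mono phik) ?lex1 //=.
  by rewrite -{1}phiK (is_kernel_mono ek) ?lex1.
by apply: idempotent_complement ek _ => x /=; rewrite phiK.
Qed.

Lemma dual_rickart_C2 : dual_rickart m -> cond_C2 m.
Proof.
move=> dual a x x' theta _ thetaiso /dual /=.
by rewrite proj_top (lattice_iso_on_top _ _ thetaiso) ?le0x.
Qed.

Lemma rickart_D2 : rickart m -> cond_D2 m.
Proof.
move=> rick a x theta _ /is_kernel_comp_rho thetak /rick.
by rewrite (is_kernel_ker thetak).
Qed.

Lemma rickart_C2_dual_rickart :
  modular_lattice L -> rickart m -> cond_C2 m -> dual_rickart m.
Proof.
move=> Lmodular rick c2 phi mphi; have phik := is_kernel_submonoid mphi.
have [k' kk'] := rick phi mphi; have k'k := is_complement_sym kk'.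
apply: (c2 _ _ _ _ k'k (kernel_complement_iso Lmodular phik kk')).
suff -> : phi \o proj k' (ker phi) = phi by [].
apply/funext => x /=; case: phik => phiE _.
by rewrite phiE (join_proj Lmodular _ k'k).
Qed.

Lemma dual_rickart_D2_rickart : dual_rickart m -> cond_D2 m -> rickart m.
Proof.
move=> dual d2 phi mphi; have phik := is_kernel_submonoid mphi.
apply: d2 (dual _ mphi) (is_kernel_iso phik) _.
suff -> : phi \o rho (ker phi) = phi by [].
by apply/funext => x /=; case: phik => phiE _; rewrite /rho joinC -phiE.
Qed.

Lemma rickart_dual_rickart_endoregular : modular_lattice L ->
  closed_under_complements m -> rickart m -> dual_rickart m -> endoregular m.
Proof.
move=> Lmodular m_compl rick dual phi mphi.
have phik := is_kernel_submonoid mphi.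
have [k' kk'] := rick phi mphi; have [a' aa'] := dual phi mphi.
have phiiso := kernel_complement_iso Lmodular phik kk'.
exists ('pinv_(fun=> \bot) `[\bot, k']%classic phi \o proj (phi \top) a').
  apply: m_compl mphi _ aa' phiiso.
  by exists (ker phi); apply: is_complement_sym.
apply/funext => x /=.
have phix : phi x <= phi \top by rewrite (is_kernel_mono phik) ?lex1.
rewrite proj_id // pinvK // inE.
by case: phiiso => -[_ _ surj] _ _; apply: surj; rewrite in_lower_interval.
Qed.

End Conditions.

Theorem theorem3p12 (d : Order.disp_t) (L : tbLatticeType d)
    (Lcomplete : complete_lattice L) (Lmodular : modular_lattice L)
    (m : set (L -> L)) (m_submonoid : submonoid_with_zero m)
    (m_compl : closed_under_complements m) :
  [<-> endoregular m;
       rickart m /\ cond_C2 m;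
       dual_rickart m /\ cond_D2 m;
       forall phi, m phi -> complemented (ker phi) /\ complemented (phi \top)].
Proof.
tfae.
- move=> reg; split; first exact: (endoregular_rickart m_submonoid).
  exact/dual_rickart_C2/(endoregular_dual_rickart m_submonoid).
- move=> [rick c2]; split; last exact: rickart_D2.
  exact: (rickart_C2_dual_rickart m_submonoid).
- move=> [dual d2] phi mphi; split; last exact: dual.
  exact: (dual_rickart_D2_rickart m_submonoid).
- move=> compl.
  apply: (rickart_dual_rickart_endoregular m_submonoid Lmodular m_compl).
    by move=> phi /compl[].
  by move=> phi /compl[].
Qed.
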